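(* Let $\mathcal{E}$ be a collection of spaces. If $f:X\to Y$ and $g:Y\to Z$ are maps, then $$\mathcal{E}\text{-}\mathrm{cat}_{\mathrm{CP}}(g)+1\le(\mathrm{secat}(f)+1)\,(\mathcal{E}\text{-}\mathrm{cat}_{\mathrm{CP}}(gf)+1).$$
   Context: All spaces are assumed to have the homotopy type of connected CW-complexes; spaces have no base points and maps are not required to preserve base points. A collection $\mathcal{E}$ of spaces means any collection of spaces containing the one-point space $*$. Given $f:X\to Y$, a subset $U\subseteq Y$ with inclusion $i:U\hookrightarrow Y$ is $\mathcal{E}$-section-categorical (with respect to $f$) if there are a space $E\in\mathcal{E}$ and maps $u:U\to E$, $v:E\to X$ with $fvu\simeq i$. The (reduced) $\mathcal{E}$-sectional category $\mathcal{E}\text{-}\mathrm{secat}(f)$ is the smallest integer $n\ge 0$ such that $Y$ has an open cover by $n+1$ subsets each of which is $\mathcal{E}$-section-categorical with respect to $f$ (and $\infty$ if no such $n$ exists). When $\mathcal{E}$ is the collection of all spaces, write $\mathrm{secat}(f)$ for $\mathcal{E}\text{-}\mathrm{secat}(f)$. The (reduced) $\mathcal{E}$-Clapp-Puppe category $\mathcal{E}\text{-}\mathrm{cat}_{\mathrm{CP}}(f)$ of a map $f:X\to Y$ is the smallest integer $n\ge0$ such that there are an open cover $\{U_0,\dots,U_n\}$ of $X$, spaces $E_i\in\mathcal{E}$ and maps $u_i:U_i\to E_i$, $v_i:E_i\to Y$ with $f|_{U_i}\simeq v_iu_i$ for each $i$ ($\infty$ if no such $n$ exists). *)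

(* Defs.v *)
From HB Require Import structures.
From mathcomp Require Import all_boot all_order all_algebra.
From mathcomp Require Import all_classical all_reals all_analysis.

Set Implicit Arguments.
Unset Strict Implicit.
Unset Printing Implicit Defensive.

Import Order.TTheory GRing.Theory Num.Theory.
Import numFieldNormedType.Exports.

Local Open Scope classical_set_scope.
Local Open Scope ring_scope.

Section Homotopy.
Variable R : realType.

(* A homotopy S x [0,1] -> T is a function on S x R of which only the
   restriction to S x [0,1] matters. *)
Definition homotopic (S T : topologicalType) (f g : S -> T) : Prop :=
  exists H : S * R -> T,
    [/\ {within [set: S] `*` `[0, 1], continuous H},
        forall x, H (x, 0) = f x &
        forall x, H (x, 1) = g x].

Definition homotopy_equivalent (S T : topologicalType) : Prop :=
  exists (h : S -> T) (k : T -> S),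
    [/\ continuous h, continuous k,
        homotopic (k \o h) idfun & homotopic (h \o k) idfun].

End Homotopy.

Section CWComplex.
Variable R : realType.

(* The library norm on row vectors is the sup norm. *)
Definition euclid_sqnorm (n : nat) (x : 'rV[R]_n) : R := \sum_i x 0 i ^+ 2.

(* For n = 0 the disk and its interior are the one-point space and the boundary
   sphere is empty. *)
Definition disk (n : nat) : set 'rV[R]_n := [set x | euclid_sqnorm x <= 1].
Arguments disk : clear implicits.

Definition disk_interior (n : nat) : set (disk n) :=
  [set x | euclid_sqnorm (set_val x) < 1].
Arguments disk_interior : clear implicits.

Definition disk_boundary (n : nat) : set (disk n) :=
  [set x | euclid_sqnorm (set_val x) = 1].
Arguments disk_boundary : clear implicits.

(* Whitehead's definition: a Hausdorff space with cells indexed by I, the i-th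
   one of dimension n i with characteristic map Phi i. *)
Record cw_structure (X : topologicalType) (I : Type) (n : I -> nat)
    (Phi : forall i, disk (n i) -> X)
    (cell := fun i => Phi i @` disk_interior (n i)) : Prop := CWStructure {
  cw_hausdorff : hausdorff_space X ;
  cw_continuous : forall i, continuous (Phi i) ;
  (* the next two: Phi i restricts to a homeomorphism from the open disk onto
     cell i, the latter with the topology induced by X *)
  cw_injective : forall i x y, disk_interior (n i) x ->
    disk_interior (n i) y -> Phi i x = Phi i y -> x = y ;
  cw_open : forall i (B : set (disk (n i))),
    open B -> B `<=` disk_interior (n i) ->
    exists2 V : set X, open V & Phi i @` B = V `&` cell i ;
  cw_disjoint : trivIset [set: I] cell ;
  cw_cover : \bigcup_i cell i = [set: X] ;
  cw_closure_finite : forall i, exists F : set I,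
    [/\ finite_set F, forall j, F j -> (n j < n i)%N &
        Phi i @` disk_boundary (n i) `<=` \bigcup_(j in F) cell j] ;
  cw_weak_topology : forall A : set X,
    closed A <-> forall i, closed (A `&` closure (cell i)) }.

Definition is_cw_complex (X : topologicalType) : Prop :=
  exists (I : Type) (n : I -> nat) (Phi : forall i, disk (n i) -> X),
    cw_structure Phi.

End CWComplex.
Arguments disk R n : clear implicits.
Arguments disk_interior R n : clear implicits.
Arguments disk_boundary R n : clear implicits.

Section Category.
Variable R : realType.

(* "Space" in the sense of the standing assumption: the homotopy type of a
   connected (in particular nonempty) CW-complex. *)
Definition is_space (X : topologicalType) : Prop :=
  exists K : topologicalType,
    [/\ is_cw_complex R K, [set: K] !=set0, connected [set: K] &
        homotopy_equivalent R X K].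

Definition is_collection (E : topologicalType -> Prop) : Prop :=
  (forall T, E T -> is_space T) /\
  (exists2 P : topologicalType, E P & exists p : P, [set: P] = [set p]).

Definition least_nat (P : nat -> Prop) : \bar R :=
  if pselect (exists n, `[< P n >]) is left exP then (ex_minn exP)%:R%:E
  else +oo%E.

Definition open_cover (X : topologicalType) (n : nat) (U : 'I_n -> set X) :=
  (forall i, open (U i)) /\ \bigcup_i U i = [set: X].

Variable E : topologicalType -> Prop.

(* Subsets are not required to be spaces in the sense of is_space. *)
Definition section_categorical (X Y : topologicalType) (f : X -> Y)
    (U : set Y) : Prop :=
  exists (T : topologicalType) (u : U -> T) (v : T -> X),
    [/\ E T, continuous u, continuous v &
        homotopic R (f \o v \o u) (set_val : U -> Y)].

Definition Esecat (X Y : topologicalType) (f : X -> Y) : \bar R :=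
  least_nat (fun n => exists U : 'I_n.+1 -> set Y,
    open_cover U /\ forall i, section_categorical f (U i)).

Definition catCP (X Y : topologicalType) (f : X -> Y) : \bar R :=
  least_nat (fun n => exists U : 'I_n.+1 -> set X,
    open_cover U /\
    forall i, exists (T : topologicalType) (u : U i -> T) (v : T -> Y),
      [/\ E T, continuous u, continuous v &
          homotopic R (f \o (set_val : U i -> X)) (v \o u)]).

End Category.

Definition secat (R : realType) (X Y : topologicalType) (f : X -> Y) : \bar R :=
  Esecat R (is_space R) f.

(* Main.v *)
Require Import Defs.
From HB Require Import structures.
From mathcomp Require Import all_boot all_order all_algebra.
From mathcomp Require Import all_classical all_reals all_analysis.
From mathcomp Require Import lra.
Import numFieldNormedType.Exports.

(** The idea is to refine the two covers against each other.  Suppose that [Y]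
is covered by [m + 1] open sets [V], each with a map [s : V -> X] such that
[f \o s] is homotopic to the inclusion of [V], and [X] by [n + 1] open sets
[U] on each of which [g \o f] factors, up to homotopy, through a space
satisfying [E] ([catCP_factors]).  The sets [s @^-1` U] are open in [V], hence
in [Y]; there are [(m + 1) * (n + 1)] of them and they cover [Y].  On
[s @^-1` U] the map [g] is homotopic to [g \o f \o s], which is the
restriction of [g \o f] to [U] preceded by [s], and so it factors through
the space that belongs to [U] ([catCP_factors_pullback]).  If one of the two
covers does not exist, the right-hand side is infinite, its factors being
positive.

The homotopy theory needed is that homotopy is symmetric, transitive and
compatible with composition.  A homotopy is only required to be continuous on
[S * [0, 1]]; extending it to a continuous map on all of [S * R] by projecting
[R] onto [0, 1] ([homotopicP]) reduces these facts to continuity on whole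
spaces. *)

Set Implicit Arguments.
Unset Strict Implicit.
Unset Printing Implicit Defensive.

Import Order.TTheory GRing.Theory Num.Theory.

Local Open Scope classical_set_scope.
Local Open Scope ring_scope.

(** * Homotopies *)

Section Homotopies.
Variable R : realType.

Lemma continuous_map_snd (S A B : topologicalType) (k : A -> B) :
  continuous k -> continuous (fun p : S * A => (p.1, k p.2)).
Proof.
move=> ck p; apply: cvg_pair; first exact: cvg_fst.
by apply: (continuous_comp (@cvg_snd _ _ _ _ _)); exact: ck.
Qed.

Lemma continuous_map_fst (S S' A : topologicalType) (h : S' -> S) :
  continuous h -> continuous (fun p : S' * A => (h p.1, p.2)).
Proof.
move=> ch p; apply: cvg_pair; last exact: cvg_snd.
by apply: (continuous_comp (@cvg_fst _ _ _ _ _)); exact: ch.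
Qed.

Lemma continuous_comp_within (S T W : topologicalType) (A : set T)
    (h : S -> T) (k : T -> W) :
  continuous h -> (forall x, A (h x)) -> {within A, continuous k} ->
  continuous (k \o h).
Proof.
move=> ch Ah /subspace_continuousP ck x.
apply: (cvg_comp _ _ _ (ck _ (Ah x))) => P /= AP.
have hAP : nbhs x (h @^-1` [set z | A z -> P z]) := ch x _ AP.
by apply: (@filterS _ (nbhs x) _ _ _ _ hAP) => z; apply; exact: Ah.
Qed.

Definition unit_clamp (t : R) : R := Num.max 0 (Num.min t 1).

Lemma unit_clamp_itv t : unit_clamp t \in `[0, 1].
Proof.
by rewrite in_itv /= /unit_clamp le_max lexx /= ge_max ler01 ge_min lexx orbT.
Qed.

Lemma unit_clamp_continuous : continuous unit_clamp.
Proof.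
move=> t; rewrite /unit_clamp.
apply: (@continuous2_cvg _ _ _ _ _ _ _ _ (fun a b : R => Num.max a b)).
- exact: (@max_continuous _ R (0, Num.min t 1)).
- exact: cvg_cst.
- apply: (@continuous2_cvg _ _ _ _ _ _ _ _ (fun a b : R => Num.min a b)).
  + exact: (@min_continuous _ R (t, 1)).
  + exact: cvg_id.
  + exact: cvg_cst.
Qed.

(** Precomposing with the retraction [unit_clamp] extends a homotopy to all of
[S * R]. *)
Lemma homotopicP (S T : topologicalType) (f g : S -> T) :
  homotopic R f g <-> exists H : S * R -> T,
    [/\ continuous H, forall x, H (x, 0) = f x & forall x, H (x, 1) = g x].
Proof.
split=> -[H [cH H0 H1]]; last first.
  by exists H; split => //; exact: continuous_subspaceT.
exists (H \o fun p => (p.1, unit_clamp p.2)); split => [|x|x] /=.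
- apply: continuous_comp_within cH; last first.
    by move=> p; split => //=; exact: unit_clamp_itv.
  exact: continuous_map_snd unit_clamp_continuous.
- by rewrite /unit_clamp min_l // maxxx.
- by rewrite /unit_clamp minxx max_r.
Qed.

Lemma homotopic_sym (S T : topologicalType) (f g : S -> T) :
  homotopic R f g -> homotopic R g f.
Proof.
move=> /homotopicP[H [cH H0 H1]]; apply/homotopicP.
exists (H \o fun p => (p.1, 1 - p.2)); split => [p|x|x] /=; last 2 first.
- by rewrite subr0.
- by rewrite subrr.
apply: continuous_comp; last exact: cH.
apply: (@continuous_map_snd S _ _ (fun t : R => 1 - t)) => t.
by apply: cvgB; [exact: cvg_cst | exact: cvg_id].
Qed.

Lemma homotopic_trans (S T : topologicalType) (f g h : S -> T) :
  homotopic R f g -> homotopic R g h -> homotopic R f h.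
Proof.
move=> /homotopicP[H [cH H0 H1]] /homotopicP[K [cK K0 K1]]; apply/homotopicP.
pose H' := H \o fun p => (p.1, p.2 *+ 2).
pose K' := K \o fun p => (p.1, p.2 *+ 2 - 1).
have cdouble : continuous (fun t : R => t *+ 2).
  by move=> t; apply: cvgMn; exact: cvg_id.
have cH' : continuous H'.
  move=> p; apply: continuous_comp; last exact: cH.
  exact: (continuous_map_snd cdouble).
have cK' : continuous K'.
  move=> p; apply: continuous_comp; last exact: cK.
  apply: (@continuous_map_snd S _ _ (fun t : R => t *+ 2 - 1)) => t.
  by apply: cvgB; [exact: cdouble | exact: cvg_cst].
pose A := [set p : S * R | p.2 <= 2^-1].
pose B := [set p : S * R | 2^-1 <= p.2].
exists (fun p => if p.2 <= 2^-1 then H' p else K' p); split => [|x|x] /=.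
- apply/continuous_subspace_setT.
  have -> : [set: S * R] = A `|` B.
    apply/seteqP; split => // p _.
    by case: (leP p.2 2^-1) => [|/ltW]; [left|right].
  apply: withinU_continuous.
  + apply: (@preimage_closed _ _ (@snd S R) [set t | t <= 2^-1]);
      last exact: closed_le.
    by move=> p _; exact: cvg_snd.
  + apply: (@preimage_closed _ _ (@snd S R) [set t | 2^-1 <= t]);
      last exact: closed_ge.
    by move=> p _; exact: cvg_snd.
  + apply: (@subspace_eq_continuous _ A _ H'); last exact: continuous_subspaceT.
    by move=> p /set_mem; rewrite /A /from_subspace /= => ->.
  + apply: (@subspace_eq_continuous _ B _ K'); last exact: continuous_subspaceT.
    move=> [x t] /set_mem; rewrite /B /from_subspace /= => tge.
    case: ifP => // tle.
    (* on the overlap t = 1/2 both halves are g *)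
    have -> : t = 2^-1 by apply/eqP; rewrite eq_le tle tge.
    have e : 2^-1 *+ 2 = 1 :> R by lra.
    by rewrite /H' /K' /= e subrr H1 K0.
- by rewrite invr_ge0 ler0n /H' /= mul0rn.
- rewrite ifF; last by apply/negbTE; rewrite -ltNge; lra.
  by rewrite /K' /= mulr2n addrK.
Qed.

Lemma homotopic_postcomp (S T W : topologicalType) (f g : S -> T) (k : T -> W) :
  continuous k -> homotopic R f g -> homotopic R (k \o f) (k \o g).
Proof.
move=> ck /homotopicP[H [cH H0 H1]]; apply/homotopicP.
exists (k \o H); split => [p|x|x] /=; rewrite ?H0 ?H1 //.
by apply: continuous_comp; [exact: cH | exact: ck].
Qed.

Lemma homotopic_precomp (S' S T : topologicalType) (f g : S -> T) (h : S' -> S) :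
  continuous h -> homotopic R f g -> homotopic R (f \o h) (g \o h).
Proof.
move=> ch /homotopicP[H [cH H0 H1]]; apply/homotopicP.
exists (H \o fun p => (h p.1, p.2)); split => [p|x|x] /=; rewrite ?H0 ?H1 //.
by apply: continuous_comp; [exact: (continuous_map_fst ch) | exact: cH].
Qed.

End Homotopies.

(** * Subspaces *)

Lemma set_val_continuous (X : topologicalType) (A : set X) :
  continuous (set_val : A -> X).
Proof. exact: initial_continuous. Qed.

Lemma set_val_inj (X : Type) (A : set X) : injective (set_val : A -> X).
Proof. exact: val_inj. Qed.

Lemma corestrict_continuous (S X : topologicalType) (A : set X) (h : S -> X) :
  continuous h -> (forall x, A (h x)) ->
  exists2 h' : S -> A, continuous h' & forall x, set_val (h' x) = h x.
Proof.
move=> ch Ah; exists (fun x => SigSub (mem_set (Ah x))) => //.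
exact: continuous_comp_initial.
Qed.

Lemma open_image_set_val (Y : topologicalType) (V : set Y) (D : set V) :
  open V -> open D -> open (set_val @` D).
Proof.
move=> oV [G oG <-].
suff -> : set_val @` (set_val @^-1` G : set V) = G `&` V by exact: openI.
apply/seteqP; split => [_ [x Gx <-]|y [Gy Vy]].
  by split => //; exact: set_valP.
by exists (SigSub (mem_set Vy)).
Qed.

(** * The two categories *)

Lemma least_natP (R : realType) (P : nat -> Prop) :
  least_nat R P = +oo%E \/ exists2 n, P n & least_nat R P = n%:R%:E.
Proof.
rewrite /least_nat; case: pselect => [exP|_]; last by left.
by right; case: ex_minnP => n /asboolP Pn _; exists n.
Qed.

Lemma least_nat_le (R : realType) (P : nat -> Prop) n :
  P n -> (least_nat R P <= n%:R%:E)%E.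
Proof.
move=> Pn; rewrite /least_nat; case: pselect => [exP|[]]; last first.
  by exists n; exact/asboolP.
by case: ex_minnP => m _ /(_ n (asboolT Pn)) mn; rewrite lee_fin ler_nat.
Qed.

Section CategoryProduct.
Variables (R : realType) (E : topologicalType -> Prop).

Definition catCP_factors (X Y : topologicalType) (f : X -> Y) (U : set X) :=
  exists (T : topologicalType) (u : U -> T) (v : T -> Y),
    [/\ E T, continuous u, continuous v &
        homotopic R (f \o (set_val : U -> X)) (v \o u)].

(** Indexing by an arbitrary finite type allows covers indexed by pairs. *)
Lemma catCP_le (X Y : topologicalType) (f : X -> Y) (I : finType) (n : nat)
    (U : I -> set X) :
  #|I| = n.+1 -> (forall i, open (U i)) -> \bigcup_i U i = [set: X] ->
  (forall i, catCP_factors f (U i)) -> (catCP R E f <= n%:R%:E)%E.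
Proof.
move=> cardI oU covU fU; apply: least_nat_le.
exists (fun k => U (enum_val (cast_ord (esym cardI) k))); split; last first.
  by move=> k; exact: fU.
split => [k|]; first exact: oU.
rewrite -covU; apply/seteqP; split => x [i _ Ux].
  by exists (enum_val (cast_ord (esym cardI) i)).
by exists (cast_ord cardI (enum_rank i)) => //; rewrite cast_ordK enum_rankK.
Qed.

(** Writing [j] for the inclusion of [s @^-1` U] into [V] and [r] for the map
[s @^-1` U -> U] induced by [s], the map [g] restricted to [s @^-1` U] is
homotopic to [g \o f \o s \o j = g \o f \o set_val \o r]. *)
Lemma catCP_factors_pullback (X Y Z : topologicalType) (f : X -> Y)
    (g : Y -> Z) (V : set Y) (s : V -> X) (U : set X) :
  continuous g -> continuous s ->
  homotopic R (f \o s) (set_val : V -> Y) ->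
  catCP_factors (g \o f) U -> catCP_factors g (set_val @` (s @^-1` U)).
Proof.
move=> cg cs fs [T [u [v [ET cu cv guv]]]].
set W := set_val @` _.
have [j cj jE] : exists2 j : W -> V, continuous j &
    forall w, set_val (j w) = set_val w.
  apply: corestrict_continuous; first exact: set_val_continuous.
  by move=> w; rewrite set_valE; have [y _ <-] := set_valP w; exact: set_valP.
have Us w : U (s (j w)).
  have [y Usy yE] := set_valP w.
  suff -> : j w = y by [].
  by apply: set_val_inj; rewrite jE; exact: esym yE.
have csj : continuous (s \o j).
  by move=> w; apply: continuous_comp; [exact: cj | exact: cs].
have [r cr rE] := corestrict_continuous csj Us.
exists T, (u \o r), v; split => //.
  by move=> w; apply: continuous_comp; [exact: cr | exact: cu].
have -> : g \o (set_val : W -> Y) = (g \o (set_val : V -> Y)) \o j.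
  by apply/funext => w /=; rewrite jE.
apply: (@homotopic_trans _ _ _ _ ((g \o (f \o s)) \o j)).
  apply: homotopic_precomp => //; apply: homotopic_postcomp => //.
  exact: homotopic_sym.
have -> : (g \o (f \o s)) \o j = (g \o f \o (set_val : U -> X)) \o r.
  by apply/funext => w /=; rewrite rE.
exact: (homotopic_precomp cr guv).
Qed.

End CategoryProduct.

Theorem proposition5p6 (R : realType) (E : topologicalType -> Prop)
  (hE : is_collection R E) (X Y Z : topologicalType)
  (hX : is_space R X) (hY : is_space R Y) (hZ : is_space R Z)
  (f : X -> Y) (g : Y -> Z) (cf : continuous f) (cg : continuous g) :
  (catCP R E g + 1 <= (secat R f + 1) * (catCP R E (g \o f) + 1))%E.
Proof.
have natS n : (n%:R%:E + 1 = n.+1%:R%:E :> \bar R)%E.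
  by rewrite -EFinD natr1.
have natS_gt0 n : (0 < n.+1%:R%:E :> \bar R)%E by rewrite lte_fin ltr0n.
rewrite /secat /Esecat; set Psecat := fun n : nat => exists _, _.
have [->|[m [V [[oV covV] secV]] ->]] := least_natP R Psecat;
    rewrite {1 2}/catCP; set PcatCP := (fun n : nat => exists U : _ -> set X, _);
    have [->|[n [U [[oU covU] facU]] ->]] := least_natP R PcatCP;
    rewrite ?natS ?addye ?mulyy ?gt0_muley ?gt0_mulye ?leey //.
have secE : forall j, exists s : V j -> X,
    continuous s /\ homotopic R (f \o s) (set_val : V j -> Y).
  move=> j; have [T [u [v [_ cu cv fvu]]]] := secV j.
  exists (v \o u); split => //.
  by move=> y; apply: continuous_comp; [exact: cu | exact: cv].
pose s j := projT1 (cid (secE j)); have sP j := projT2 (cid (secE j)).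
pose W (p : 'I_m.+1 * 'I_n.+1) := set_val @` (s p.1 @^-1` U p.2).
have oW p : open (W p).
  apply: open_image_set_val => //.
  have [cs _] := sP p.1.
  by move/continuousP: cs; apply.
have covW : \bigcup_p W p = [set: Y].
  apply/seteqP; split => // y _.
  have [j _ Vy] : (\bigcup_i V i) y by rewrite covV.
  pose y' : V j := SigSub (mem_set Vy).
  have [i _ Ui] : (\bigcup_i U i) (s j y') by rewrite covU.
  by exists (j, i) => //; exists y'.
have facW p : catCP_factors R E g (W p).
  have [cs fs] := sP p.1.
  exact: (catCP_factors_pullback cg cs fs (facU p.2)).
have cardI : #|{: 'I_m.+1 * 'I_n.+1}| = (m.+1 * n.+1).-1.+1.
  by rewrite card_prod !card_ord.
apply: (@le_trans _ _ ((m.+1 * n.+1).-1%:R%:E + 1)%E).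
  by apply: leeD2r; exact: (catCP_le cardI oW covW facW).
by rewrite natS -EFinM -natrM.
Qed.
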